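(* Let $((\Omega,P),\{p_\mu(\cdot):\mu\in\mathcal M\},\mathcal F)$ be a good observation scheme (see context) and let $X\subset\mathcal M$, $Y\subset\mathcal M$ be nonempty convex compact sets. Define $\Phi:\mathcal F\times(X\times Y)\to\mathbb R$ by $$\Phi(\phi,[x;y])=\ln\Big(\int_\Omega e^{-\phi(\omega)}p_x(\omega)P(d\omega)\Big)+\ln\Big(\int_\Omega e^{\phi(\omega)}p_y(\omega)P(d\omega)\Big).$$ (i) $\Phi$ is continuous on its domain, convex in $\phi\in\mathcal F$, concave in $[x;y]\in X\times Y$, and possesses a saddle point ($\min$ in $\phi$, $\max$ in $[x;y]$) $(\phi_*(\cdot),[x_*;y_*])$ on $\mathcal F\times(X\times Y)$. Without loss of generality (after shifting $\phi_*$ by a constant, which preserves the saddle point property) $\phi_*$ can be assumed to satisfy $$\int_\Omega e^{-\phi_*(\omega)}p_{x_*}(\omega)P(d\omega)=\int_\Omega e^{\phi_*(\omega)}p_{y_*}(\omega)P(d\omega).\qquad( * )$$ Fix a saddle point satisfying $( * )$ and denote by $\varepsilon_\star$ the common value of the two quantities in $( * )$. Then the saddle point value $\min_{\phi\in\mathcal F}\max_{[x;y]\in X\times Y}\Phi(\phi,[x;y])$ equals $2\ln(\varepsilon_\star)$, and the risk of the simple test associated with the detector $\phi_*$ on the composite hypotheses $H_X,H_Y$ is $\le\varepsilon_\star$. Moreover, for every $a\in\mathbb R$, for the simple test with the detector $\phi_*^a(\cdot)=\phi_*(\cdot)-a$, the probabilities $\epsilon_X$ to reject $H_X$ when it is true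 and $\epsilon_Y$ to reject $H_Y$ when it is true satisfy $$\epsilon_X\le e^{a}\varepsilon_\star,\qquad \epsilon_Y\le e^{-a}\varepsilon_\star.$$ (ii) Let $\epsilon\ge0$ be such that there exists a test (of any form) for deciding between the two simple hypotheses $$(A):\ \omega\sim p_{x_*}(\cdot),\qquad (B):\ \omega\sim p_{y_*}(\cdot)$$ with the sum of error probabilities $\le 2\epsilon$. Then $\varepsilon_\star\le 2\sqrt{\epsilon(1-\epsilon)}$. In other words, if $(A)$, $(B)$ can be decided, by any test, with the sum of error probabilities $2\epsilon$, then the risk of the simple test with detector $\phi_*$ on the composite hypotheses $H_X,H_Y$ does not exceed $2\sqrt{\epsilon(1-\epsilon)}$. (iii) The detector $\phi_*$ specified in (i) (i.e., satisfying $( * )$) is given by the $[x;y]$-component $[x_*;y_*]$ of the associated saddle point of $\Phi$: $$\phi_*(\cdot)=\tfrac12\ln\big(p_{x_*}(\cdot)/p_{y_*}(\cdot)\big).$$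
   Context: A collection $((\Omega,P),\{p_\mu(\cdot):\mu\in\mathcal M\},\mathcal F)$ is called a good observation scheme if: (1) $\mathcal M\subset\mathbb R^m$ is a convex set which coincides with its relative interior. (2) $\Omega$ is a Polish (separable complete metric) space equipped with a Borel $\sigma$-additive $\sigma$-finite measure $P$ with $\mathrm{supp}(P)=\Omega$; for each $\mu\in\mathcal M$, $p_\mu$ is the density with respect to $P$ of a probability distribution $P_\mu$ on $\Omega$; $p_\mu(\omega)$ is positive and continuous in $\mu\in\mathcal M,\omega\in\Omega$; and for every compact $M\subset\mathcal M$ there is a Borel function $p^M$ on $\Omega$ with $\int_\Omega p^M(\omega)P(d\omega)<\infty$ and $p_\mu(\omega)\le p^M(\omega)$ for all $\mu\in M$, $\omega\in\Omega$. (3) $\mathcal F$ is a finite-dimensional linear space of continuous real functions on $\Omega$ which contains the constants and satisfies $\ln(p_\mu(\cdot)/p_\nu(\cdot))\in\mathcal F$ for all $\mu,\nu\in\mathcal M$. (4) For every $\phi\in\mathcal F$, the function $F_\phi(\mu)=\ln\left(\int_\Omega e^{\phi(\omega)}p_\mu(\omega)P(d\omega)\right)$ is well defined and concave in $\mu\in\mathcal M$. Given an observation $\omega\sim P_\mu$ with unknown $\mu\in\mathcal M$ known to belong either to $X$ or to $Y$, hypothesis $H_X$ states that $\mu\in X$ and $H_Y$ states that $\mu\in Y$. A test is a Borel function $T:\Omega\to\{-1,1\}$; it accepts the first hypothesis (and rejects the second) when $T(\omega)=1$, and accepts the second (and rejects the first) when $T(\omega)=-1$. Its error probabilities are $\epsilon_X=\sup_{x\in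 X}P_x\{T=-1\}$ and $\epsilon_Y=\sup_{y\in Y}P_y\{T=1\}$, and its risk is $\max\{\epsilon_X,\epsilon_Y\}$. The simple test with detector $\phi\in\mathcal F$ accepts $H_X$ if $\phi(\omega)\ge0$ and accepts $H_Y$ otherwise.
   Formalization: Part (ii) is stated for 0 ≤ ε ≤ 1/2; for ε > 1/2 it fails as written: with X = Y = {x}, ε⋆ = 1 and a constant test has error sum 1 ≤ 2ε, while 2√(ε(1−ε)) < 1. *)

(* Defs.v *)
From HB Require Import structures.
From mathcomp Require Import all_boot all_order all_algebra.
From mathcomp Require Import all_classical all_reals all_analysis.

Set Implicit Arguments.
Unset Strict Implicit.
Unset Printing Implicit Defensive.

Import Order.TTheory GRing.Theory Num.Theory.
Import numFieldNormedType.Exports.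

Local Open Scope classical_set_scope.
Local Open Scope ring_scope.
Local Open Scope convex_scope.

#[short(type="completeMetricType")]
HB.structure Definition CompleteMetric (R : numDomainType) :=
  {T of CompletePseudoMetric R T & Metric R T}.

Definition separable (T : topologicalType) :=
  exists2 D : set T, countable D & dense D.

Notation borelType T := (g_sigma_algebraType (@open T)).

Section convexity.
Context {R : realType}.

Definition affine_set (E : lmodType R) (A : set E) :=
  forall (x y : E) (t : R), A x -> A y -> A (x + t *: (y - x)).

Definition affine_hull (E : lmodType R) (A : set E) : set E :=
  smallest (@affine_set E) A.

Definition relative_interior (E : normedModType R) (A : set E) : set E :=
  [set x | A x /\ \forall y \near x, affine_hull A y -> A y].

Definition concave_function (E : lmodType R) (E' := convex_lmodType E)
    (D : set E') (f : E' -> R^o) :=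
  forall t : {i01 R},
    {in D &, forall x y : E', f x <| t |> f y <= f (x <| t |> y)}.

End convexity.

Section saddle_points.
Context {R : realType} {U V : Type}.
Implicit Types (A : set U) (B : set V) (f : U -> V -> R).

Definition maximums (S : set R) : set R := S `&` ubound S.
Definition minimums (S : set R) : set R := S `&` lbound S.

(* Minimum in the first argument, maximum in the second one. *)
Definition saddle_point A B f (u : U) (v : V) :=
  [/\ A u, B v, (forall u', A u' -> f u v <= f u' v) &
      (forall v', B v' -> f u v' <= f u v)].

(* [c] is the minimum over [u] in [A] of the maximum over [v] in [B] of
   [f u v], all these extrema being attained. *)
Definition minmax_value A B f (c : R) :=
  exists g : U -> R,
    (forall u, A u -> maximums [set f u v | v in B] (g u)) /\
    minimums [set g u | u in A] c.

End saddle_points.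

Section function_spaces.
Context {R : realType} {T : Type}.

Definition lincomb n (e : 'I_n -> T -> R) (c : 'rV[R]_n) : T -> R :=
  fun w => \sum_(i < n) c ord0 i * e i w.

(* [e] is a basis of [F], i.e., [lincomb e] is a linear bijection from R^n
   onto [F]; the canonical topology of a finite-dimensional space [F] is the
   one transported from R^n by any such bijection. *)
Definition basis_of_space n (e : 'I_n -> T -> R) (F : set (T -> R)) :=
  injective (lincomb e) /\ range (lincomb e) = F.

Definition finite_dim_space (F : set (T -> R)) :=
  exists n (e : 'I_n -> T -> R), basis_of_space e F.

End function_spaces.

Section observation_schemes.
Context {R : realType} {Omega : completeMetricType R} {m : nat}.
Variable P : {sigma_finite_measure set (borelType Omega) -> \bar R}.

Definition measure_support : set Omega :=
  [set w | forall U : set Omega, open_nbhs w U -> (0 < P U)%E].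

(* Only the values of [p mu] for [mu] in the parameter set are meaningful. *)
Variable p : 'rV[R]_m -> Omega -> R.

Definition Pr (mu : 'rV[R]_m) (A : set Omega) : \bar R :=
  (\int[P]_(w in A) (p mu w)%:E)%E.

Definition exp_moment (phi : Omega -> R) (mu : 'rV[R]_m) : R :=
  \int[P]_w (expR (phi w) * p mu w).

Record good_observation_scheme (M : set 'rV[R]_m) (F : set (Omega -> R)) :
    Prop := GoodObservationScheme {
  gos_M_convex : convex_set M;
  gos_M_relint : relative_interior M = M;
  gos_separable : separable Omega;
  gos_support : measure_support = setT;
  gos_density : forall mu, M mu -> Pr mu setT = 1%E;
  gos_pos : forall mu w, M mu -> 0 < p mu w;
  gos_cont : {within M `*` [set: Omega],
    continuous (fun z : 'rV[R]_m * Omega => p z.1 z.2)};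
  gos_dom : forall K : set 'rV[R]_m, compact K -> K `<=` M ->
    exists pK : borelType Omega -> R,
      [/\ measurable_fun setT pK, (\int[P]_w (pK w)%:E < +oo)%E &
          forall mu w, K mu -> p mu w <= pK w];
  gos_F_fin_dim : finite_dim_space F;
  gos_F_cont : forall phi, F phi -> continuous phi;
  gos_F_cst : forall c : R, F (cst c);
  gos_F_ln : forall mu nu, M mu -> M nu -> F (fun w => ln (p mu w / p nu w));
  gos_integrable : forall phi mu, F phi -> M mu ->
    P.-integrable setT (fun w : borelType Omega =>
      (expR (phi w) * p mu w)%:E);
  gos_concave : forall phi, F phi ->
    concave_function M (fun mu => ln (exp_moment phi mu))
}.

Definition Phi (phi : Omega -> R) (xy : 'rV[R]_m * 'rV[R]_m) : R :=
  ln (exp_moment (fun w => - phi w) xy.1) + ln (exp_moment phi xy.2).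

Definition is_test (T : borelType Omega -> R) :=
  measurable_fun setT T /\ forall w, T w = 1 \/ T w = -1.

Definition simple_test (phi : Omega -> R) : Omega -> R :=
  fun w => if 0 <= phi w then 1 else -1.

Definition error_X (X : set 'rV[R]_m) (T : Omega -> R) : \bar R :=
  ereal_sup [set Pr x [set w | T w = -1] | x in X].

Definition error_Y (Y : set 'rV[R]_m) (T : Omega -> R) : \bar R :=
  ereal_sup [set Pr y [set w | T w = 1] | y in Y].

Definition risk (X Y : set 'rV[R]_m) (T : Omega -> R) : \bar R :=
  maxe (error_X X T) (error_Y Y T).

End observation_schemes.

(* Main.v *)
Require Import Defs.
From HB Require Import structures.
From mathcomp Require Import all_boot all_order all_algebra.
From mathcomp Require Import all_classical all_reals all_analysis.
From mathcomp Require Import measurable_realfun ring lra.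

Import Order.TTheory GRing.Theory Num.Theory.
Import numFieldNormedType.Exports.

Local Open Scope classical_set_scope.
Local Open Scope ring_scope.

(** Everything rests on the fact that the minimisation over detectors is
    explicit.  For fixed [x] and [y], the Cauchy-Schwarz inequality gives
      int e^(- phi) p_x . int e^phi p_y >= (int sqrt (p_x p_y))^2,
    with equality at [phi = 1/2 ln (p_x / p_y)], which belongs to [F] because
    [F] contains the log-ratios of densities.  Hence the minimum of [Phi] over
    detectors is [2 ln (affinity x y)], where the affinity is the integral of
    [sqrt (p_x p_y)] ([Phi_ge_affinity], [Phi_half_log_ratio]).

    This yields a saddle point without any minimax theorem
    ([saddle_point_exists]).  The affinity is continuous, so it is maximal at
    some [(x, y)] of the compact set [X * Y]; let [V] be the corresponding value
    of [2 ln affinity].  Given another point [z'] of [X * Y], move from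
    [z = (x, y)] to [z_t = z + t (z' - z)] and let [psi_t] be the optimal
    detector at [z_t].  By concavity of [Phi psi_t],
      V >= Phi psi_t z_t >= t Phi psi_t z' + (1 - t) Phi psi_t z
        >= t Phi psi_t z' + (1 - t) V,
    so [Phi psi_t z' <= V].  When [t] tends to 0, [psi_t] tends pointwise to the
    optimal detector at [z], and Fatou's lemma gives the inequality for that
    detector.

    Continuity of the exponential moments also comes from Fatou's lemma.  In the
    parameter, Fatou gives lower semicontinuity at a point [mu] of [M]; upper
    semicontinuity follows by applying it along the reflected parameters
    [2 mu - nu], which stay in [M] because [M] is relatively open, together
    with midpoint concavity of the logarithmic moment
    ([exp_moment_continuous]).  Joint continuity in the detector and the
    parameter then follows from dominated convergence with a moving dominating
    function ([exp_moment_lincomb_continuous]).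

    The error bounds are Markov's inequality: [1 <= e^phi] where [phi >= 0], and
    the saddle inequality in each variable separately bounds the two exponential
    moments over [X] and over [Y] by [eps].  For the comparison with arbitrary
    tests, [eps] is at most the affinity, and
      (int sqrt (p_x p_y))^2 <= int min (p_x, p_y) . int max (p_x, p_y)
                              = I (2 - I),
    where [I = int min (p_x, p_y)] is at most the sum of the error probabilities
    of any test ([affinity_sqr_le]).  Finally, a detector of a saddle point
    realises equality in Cauchy-Schwarz, which determines it almost everywhere,
    hence everywhere, as [P] has full support ([saddle_detector]). *)

(** * Sequences and continuity *)

Section sequential_continuity.
Context {R : realType} {V : pseudoMetricType R}.

Lemma within_continuous_seq (A : set V) (f : V -> R) :
  (forall (u : nat -> V) (z : V), A z -> (forall k, A (u k)) ->
     u @ \oo --> z -> f (u k) @[k --> \oo] --> f z) ->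
  {within A, continuous f}.
Proof.
move=> seqf; apply/subspace_continuousP => z Az.
apply/cvgrPdist_lt => e e0; apply: contrapT => nnear.
have bad (k : nat) : exists t, [/\ A t, ball z k.+1%:R^-1 t & e <= `|f z - f t|].
  apply: contrapT => /forallNP h; apply: nnear; apply/nbhs_ballP.
  exists k.+1%:R^-1 => //= t zt At; rewrite ltNge; apply/negP => et.
  exact: (h t).
have [u uP] := choice bad.
have uz : u @ \oo --> z.
  apply/cvg_ballP => d d0; near=> k.
  have [_ + _] := uP k; apply: le_ball; apply/ltW.
  by near: k; exact: near_infty_natSinv_lt (PosNum d0).
have /cvgrPdist_lt/(_ e e0)[N _ /(_ N (leqnn N))] :=
  seqf u z Az (fun k => let: And3 Ak _ _ := uP k in Ak) uz.
by rewrite ltNge; have [_ _ ->] := uP N.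
Unshelve. all: by end_near. Qed.

Lemma within_continuous_cvg {W : topologicalType} (A : set V) (f : V -> W)
    (u : nat -> V) (z : V) : {within A, continuous f} ->
  A z -> (\forall k \near \oo, A (u k)) -> u @ \oo --> z ->
  f (u k) @[k --> \oo] --> f z.
Proof.
move=> /subspace_continuousP cf Az Au uz.
have {}cf := cf z Az.
apply: cvg_trans cf => B /=.
rewrite nbhs_simpl /= /within /= => zB.
have := uz _ zB; rewrite nbhs_simpl /= => uB.
by apply: filterS2 Au uB => k Ak; apply.
Qed.

End sequential_continuity.

(** * Integrals of real functions *)

Section real_integrals.
Context {d} {T : measurableType d} {R : realType}
  {mu : {measure set T -> \bar R}}.
Implicit Types f g : T -> R.

Lemma fin_Rintegral f : mu.-integrable setT (EFin \o f) ->
  (\int[mu]_x (f x)%:E)%E = (\int[mu]_x f x)%:E.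
Proof. by move=> fi; rewrite /Rintegral fineK//; exact: integrable_fin_num. Qed.

Lemma integrable_measurableR {f} : mu.-integrable setT (EFin \o f) ->
  measurable_fun setT f.
Proof. by move=> /measurable_int/measurable_EFinP. Qed.

Lemma integrable_le {f} g : measurable_fun setT f -> (forall x, 0 <= f x <= g x) ->
  mu.-integrable setT (EFin \o g) -> mu.-integrable setT (EFin \o f).
Proof.
move=> mf fg; apply: le_integrable => //; first exact/measurable_EFinP.
move=> x _ /=; have /andP[f0 fgx] := fg x.
by rewrite lee_fin !ger0_norm// (le_trans f0).
Qed.

Lemma Rintegral_le0_null f (A : set T) : mu.-integrable setT (EFin \o f) ->
  (forall x, 0 <= f x) -> \int[mu]_x f x <= 0 ->
  measurable A -> (forall x, A x -> 0 < f x) -> mu A = 0%E.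
Proof.
move=> fi f0 If mA fA.
have absf0 : (\int[mu]_x `|(EFin \o f) x| = 0)%E.
  under eq_integral do rewrite /= ger0_norm//.
  rewrite fin_Rintegral//; congr EFin; apply/eqP.
  by rewrite eq_le If Rintegral_ge0.
have := (ae_eq_integral_abs mu measurableT (measurable_int _ fi)).1 absf0.
move=> f0ae; apply: measure_negligible => //.
apply: negligibleS f0ae => x Ax /= /(_ Logic.I) [fx0].
by have := fA x Ax; rewrite fx0 ltxx.
Qed.

Lemma Rintegral_gt0 f : mu setT != 0%E -> mu.-integrable setT (EFin \o f) ->
  (forall x, 0 < f x) -> 0 < \int[mu]_x f x.
Proof.
move=> mu0 fi f0; rewrite ltNge; apply: contra mu0 => If; apply/eqP.
by apply: (Rintegral_le0_null f) => // x; exact/ltW.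
Qed.

(** Fatou's lemma, with a threshold [a] in place of lower limits: this is the
    form in which lower semicontinuity is used below. *)
Lemma fatou_Rintegral (u : nat -> T -> R) f a :
  (forall k, mu.-integrable setT (EFin \o u k)) ->
  mu.-integrable setT (EFin \o f) ->
  (forall k x, 0 <= u k x) -> (forall x, u k x @[k --> \oo] --> f x) ->
  a < \int[mu]_x f x -> \forall k \near \oo, a < \int[mu]_x u k x.
Proof.
move=> ui fi u0 uf; rewrite -lte_fin -fin_Rintegral//.
have mu_ k : measurable_fun setT (EFin \o u k) by exact: measurable_int (ui k).
have := fatou mu measurableT mu_ (fun k x _ => u0 k x).
have -> : (\int[mu]_x limn_einf (fun k => (EFin \o u k) x) =
           \int[mu]_x (f x)%:E)%E.
  apply: eq_integral => x _.
  have /cvg_limn_einf_sup[-> //] : (EFin \o u k) x @[k --> \oo] --> (f x)%:E.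
  by apply: cvg_EFin; [exact: nearW|exact: uf].
move=> ifle /lt_le_trans/(_ ifle).
have /cvg_lim := @cvg_einfs_sup R (fun n => \int[mu]_x (EFin \o u n) x)%E.
rewrite limn_einf_lim => -> //.
move=> /ereal_sup_gt[_ [n _ <-]] an.
exists n => // k /= nk; rewrite -lte_fin -fin_Rintegral//.
by apply: (lt_le_trans an); apply: ereal_inf_lbound; exists k.
Qed.

(** Dominated convergence with a dominating function that varies with the index:
    Fatou's lemma for [u k] bounds the integrals from below, and Fatou's lemma
    for [v k - u k] bounds them from above.  The bounds available for
    exponential moments at varying parameters vary with the parameters too, but
    have convergent integrals. *)
Lemma cvg_Rintegral_dominated (u v : nat -> T -> R) f g :
  (forall k, mu.-integrable setT (EFin \o u k)) ->
  (forall k, mu.-integrable setT (EFin \o v k)) ->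
  mu.-integrable setT (EFin \o f) -> mu.-integrable setT (EFin \o g) ->
  (forall k x, 0 <= u k x <= v k x) ->
  (forall x, u k x @[k --> \oo] --> f x) ->
  (forall x, v k x @[k --> \oo] --> g x) ->
  \int[mu]_x v k x @[k --> \oo] --> \int[mu]_x g x ->
  \int[mu]_x u k x @[k --> \oo] --> \int[mu]_x f x.
Proof.
move=> ui vi fi gi uv uf vg Ivg.
apply/cvgrPdist_lt => e e0.
have e2 : 0 < e / 2 by rewrite divr_gt0.
have lsc_u : \forall k \near \oo, \int[mu]_x f x - e < \int[mu]_x u k x.
  apply: (fatou_Rintegral u f) => //; first by move=> k x; case/andP: (uv k x).
  by rewrite ltrBlDr ltrDl.
have lsc_vu : \forall k \near \oo,
    \int[mu]_x (g x - f x) - e / 2 < \int[mu]_x (v k x - u k x).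
  apply: (fatou_Rintegral (fun k x => v k x - u k x) (fun x => g x - f x)).
  - by move=> k; exact: (integrableB measurableT (vi k) (ui k)).
  - exact: (integrableB measurableT gi fi).
  - by move=> k x; rewrite subr_ge0; case/andP: (uv k x).
  - by move=> x; apply: cvgB.
  - by rewrite ltrBlDr ltrDl.
move/cvgrPdist_lt : Ivg => /(_ _ e2) dist_v.
near=> k.
have u_gt : \int[mu]_x f x - e < \int[mu]_x u k x by near: k.
have vu_gt : \int[mu]_x (g x - f x) - e / 2 < \int[mu]_x (v k x - u k x).
  by near: k.
have v_near : `|\int[mu]_x g x - \int[mu]_x v k x| < e / 2 by near: k.
rewrite (RintegralB measurableT gi fi) in vu_gt.
rewrite (RintegralB measurableT (vi k) (ui k)) in vu_gt.
move: v_near; rewrite !ltr_norml => /andP[? ?].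
by apply/andP; split; lra.
Unshelve. all: by end_near. Qed.

(** Hoelder's inequality in logarithmic form.  After normalising [f] and [g] to
    integral 1, it is the pointwise convexity of the exponential, integrated.
    It serves both for convexity of [Phi] in the detector and, with [t = 1/2],
    as the Cauchy-Schwarz inequality. *)
Lemma ln_Rintegral_conv f g h (t : {i01 R}) : mu setT != 0%E ->
  mu.-integrable setT (EFin \o f) -> mu.-integrable setT (EFin \o g) ->
  mu.-integrable setT (EFin \o h) ->
  (forall x, 0 < f x) -> (forall x, 0 < g x) -> (forall x, 0 < h x) ->
  (forall x, ln (h x) = t%:num * ln (f x) + (1 - t%:num) * ln (g x)) ->
  ln (\int[mu]_x h x) <=
    t%:num * ln (\int[mu]_x f x) + (1 - t%:num) * ln (\int[mu]_x g x).
Proof.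
move=> mu0 fi gi hi f0 g0 h0 hE.
have If0 := Rintegral_gt0 _ mu0 fi f0.
have Ig0 := Rintegral_gt0 _ mu0 gi g0.
have Ih0 := Rintegral_gt0 _ mu0 hi h0.
set A := \int[mu]_x f x in If0 *; set B := \int[mu]_x g x in Ig0 *.
set C := _ + _.
have hle x : h x <= expR C * (t%:num / A * f x + (1 - t%:num) / B * g x).
  have -> : h x = expR C * expR (t%:num * (ln (f x) - ln A) +
                               (1 - t%:num) * (ln (g x) - ln B)).
    by rewrite -expRD /C -[LHS]lnK ?posrE// hE; congr expR; ring.
  rewrite ler_pM2l ?expR_gt0//.
  apply: le_trans (convex_expR t _ _) _.
  rewrite convRE !expRB !lnK ?posrE//.
  rewrite le_eqVlt; apply/orP; left; apply/eqP; rewrite /unstable.onem.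
  by field; rewrite !gt_eqF.
have lei (c : R) k : mu.-integrable setT (EFin \o k) ->
    mu.-integrable setT (EFin \o (fun x => c * k x)).
  by move=> ki; exact: (integrableZl measurableT c ki).
have sumi : mu.-integrable setT
    (EFin \o (fun x => t%:num / A * f x + (1 - t%:num) / B * g x)).
  by apply: (integrableD measurableT (lei _ _ fi) (lei _ _ gi)).
rewrite -(expRK C) ler_ln ?posrE ?expR_gt0//.
apply: (le_trans (le_Rintegral measurableT hi (lei _ _ sumi) (fun x _ => hle x))).
rewrite RintegralZl// RintegralD ?RintegralZl//; [|exact: lei..].
by rewrite -/A -/B !divfK ?gt_eqF// addrC subrK mulr1.
Qed.

End real_integrals.

(** * Finite-dimensional spaces of detectors *)

Section detectors.
Context {R : realType} {T : Type} {F : set (T -> R)} (Ffin : finite_dim_space F).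

Lemma finite_dim_space_linear phi psi (a b : R) : F phi -> F psi ->
  F (fun w => a * phi w + b * psi w).
Proof.
have [n [e [_ <-]]] := Ffin.
move=> [c _ <-] [c' _ <-]; exists (a *: c + b *: c') => //.
apply/funext => w; rewrite /lincomb !mulr_sumr -big_split/=.
by apply: eq_bigr => i _; rewrite !mxE mulrDl !mulrA.
Qed.

Lemma finite_dim_spaceZ phi (a : R) : F phi -> F (fun w => a * phi w).
Proof.
move=> Fphi; have := finite_dim_space_linear phi phi a 0 Fphi Fphi.
by congr F; apply/funext => w; rewrite mul0r addr0.
Qed.

Lemma finite_dim_spaceN phi : F phi -> F (fun w => - phi w).
Proof.
move=> Fphi; have := finite_dim_spaceZ phi (-1) Fphi.
by congr F; apply/funext => w; rewrite mulN1r.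
Qed.

Lemma finite_dim_spaceD phi psi : F phi -> F psi -> F (fun w => phi w + psi w).
Proof.
move=> Fphi Fpsi; have := finite_dim_space_linear phi psi 1 1 Fphi Fpsi.
by congr F; apply/funext => w; rewrite !mul1r.
Qed.

End detectors.

Lemma lincomb_delta {R : realType} {T : Type} n (e : 'I_n -> T -> R) i :
  lincomb e (delta_mx ord0 i) = e i.
Proof.
apply/funext => w; rewrite /lincomb (bigD1 i)//= mxE !eqxx mul1r big1 ?addr0//.
by move=> j /negPf ji; rewrite mxE eqxx ji mul0r.
Qed.

(** When the [b i] are the values of a basis of detectors, the right-hand side is a
    sum of exponentials of detectors; it dominates, up to a factor, the
    exponentials of all detectors near a given one. *)
Lemma expR_sum_le {R : realType} n (a b : 'I_n -> R) :
  (forall i, a i <= `|b i|) ->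
  expR (\sum_i a i) <=
    1 + \sum_i (expR (n%:R * b i) + expR (- (n%:R * b i))).
Proof.
case: n a b => [|n] a b ab; first by rewrite !big_ord0 expR0 addr0.
(* The sum is at most [n.+1] times the largest [`|b i|]. *)
pose j := [arg max_(i > ord0) `|b i|]%O.
have jmax i : `|b i| <= `|b j|.
  by rewrite /j; case: arg_maxP => // k _; apply.
have sum_le : \sum_i a i <= n.+1%:R * `|b j|.
  rewrite mulr_natl -[n.+1 in leRHS](card_ord n.+1) -sumr_const.
  by apply: ler_sum => i _; exact: le_trans (ab i) _.
have term0 i : 0 <= expR (n.+1%:R * b i) + expR (- (n.+1%:R * b i)).
  by rewrite addr_ge0 ?expR_ge0.
rewrite -ler_expR in sum_le; apply: (le_trans sum_le).
rewrite (bigD1 j)//= addrCA ler_wpDr ?addr_ge0 ?sumr_ge0//.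
case: (ger0P (b j)) => _; first by rewrite lerDl expR_ge0.
by rewrite mulrN lerDr expR_ge0.
Qed.

(** * Exponential moments of an observation scheme *)

Section observation_scheme.
Context {R : realType} {Omega : completeMetricType R} {m : nat}
  {P : {sigma_finite_measure set (borelType Omega) -> \bar R}}
  {M : set 'rV[R]_m} {p : 'rV[R]_m -> Omega -> R} {F : set (Omega -> R)}
  (G : good_observation_scheme P p M F).

Implicit Types (phi psi : Omega -> R) (mu nu : 'rV[R]_m).

Let Ffin := gos_F_fin_dim G.

Lemma integrable_exp_moment phi mu : F phi -> M mu ->
  P.-integrable setT (EFin \o (fun w : borelType Omega => expR (phi w) * p mu w)).
Proof. exact: gos_integrable G phi mu. Qed.

Lemma integrable_density mu : M mu ->
  P.-integrable setT (EFin \o (p mu : borelType Omega -> R)).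
Proof.
move=> Mmu; have := integrable_exp_moment (cst 0) mu (gos_F_cst G 0) Mmu.
by congr integrable; apply/funext => w /=; rewrite expR0 mul1r.
Qed.

Lemma Rintegral_density mu : M mu -> \int[P]_w p mu w = 1.
Proof. by move=> /(gos_density G); rewrite /Rintegral /Pr => ->. Qed.

Lemma base_measure_neq0 mu : M mu -> P setT != 0%E.
Proof.
move=> Mmu; apply/eqP => P0; have := gos_density G Mmu.
rewrite /Pr null_set_integral//; last exact: measurable_int (integrable_density _ Mmu).
by move=> /eqP; rewrite eqe eq_sym oner_eq0.
Qed.

Lemma exp_moment_gt0 phi mu : F phi -> M mu -> 0 < exp_moment P p phi mu.
Proof.
move=> Fphi Mmu; apply: Rintegral_gt0; first exact: base_measure_neq0 Mmu.
  exact: integrable_exp_moment.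
by move=> w; rewrite mulr_gt0 ?expR_gt0 ?(gos_pos G).
Qed.

Lemma exp_momentD_cst phi mu c : F phi -> M mu ->
  exp_moment P p (fun w => phi w + c) mu = expR c * exp_moment P p phi mu.
Proof.
move=> Fphi Mmu; rewrite /exp_moment -RintegralZl//; last first.
  exact: integrable_exp_moment.
by apply: eq_Rintegral => w _; rewrite expRD; ring.
Qed.

Lemma cvg_density (u : nat -> 'rV[R]_m) mu w : (forall k, M (u k)) -> M mu ->
  u @ \oo --> mu -> p (u k) w @[k --> \oo] --> p mu w.
Proof.
move=> Mu Mmu umu.
apply: (within_continuous_cvg _ _ (fun k => (u k, w)) (mu, w) (gos_cont G)) => //.
- by apply: nearW => k; split => //=.
- exact: (cvg_pair umu (cvg_cst w)).
Qed.

Lemma cvg_reflection (u : nat -> 'rV[R]_m) mu :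
  u @ \oo --> mu -> mu + (mu - u k) @[k --> \oo] --> mu.
Proof.
move=> umu; have := cvgD (cvg_cst mu) (cvgB (cvg_cst mu) umu).
by rewrite subrr addr0; apply.
Qed.

(** The reflected points [2 mu - u k] lie in the affine hull of [M] and tend to
    [mu], near which [M] contains its affine hull. *)
Lemma relint_reflection (u : nat -> 'rV[R]_m) mu : (forall k, M (u k)) -> M mu ->
  u @ \oo --> mu -> \forall k \near \oo, M (mu + (mu - u k)).
Proof.
move=> Mu Mmu umu.
have [_ hull_near] : relative_interior M mu by rewrite (gos_M_relint G).
have : \forall k \near \oo, affine_hull M (mu + (mu - u k)) -> M (mu + (mu - u k)).
  exact: (cvg_reflection _ _ umu _ hull_near).
apply: filterS => k; apply.
move=> A [Aaff MA].
have := Aaff (u k) mu 2 (MA _ (Mu k)) (MA _ Mmu).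
by rewrite scaler_nat mulr2n addrA [u k + _]addrC subrK.
Qed.

Lemma exp_moment_midpoint phi mu nu lam : F phi -> M mu -> M nu -> M lam ->
  mu + nu = lam *+ 2 ->
  exp_moment P p phi mu * exp_moment P p phi nu <= exp_moment P p phi lam ^+ 2.
Proof.
move=> Fphi Mmu Mnu Mlam midE.
have half01 : 0 <= (2^-1 : R) <= 1 by lra.
have [h0 h1] := andP half01.
have := gos_concave G Fphi (Itv01 h0 h1) (mem_set Mmu) (mem_set Mnu).
rewrite convRE/= /unstable.onem.
have -> : conv (Itv01 h0 h1) (mu : convex_lmodType _) nu = lam.
  transitivity (2^-1 *: mu + (1 - 2^-1) *: nu) => //.
  have -> : 1 - 2^-1 = 2^-1 :> R by lra.
  by rewrite -scalerDr midE -[lam *+ 2]scaler_nat scalerA mulVf ?scale1r.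
have mu0 := exp_moment_gt0 _ _ Fphi Mmu.
have nu0 := exp_moment_gt0 _ _ Fphi Mnu.
have lam0 := exp_moment_gt0 _ _ Fphi Mlam.
move=> lnle; rewrite -ler_ln ?posrE ?mulr_gt0 ?exprn_gt0//.
rewrite lnM ?posrE// expr2 lnM ?posrE//; lra.
Qed.

Lemma exp_moment_lsc (phi_ : nat -> Omega -> R) phi (u : nat -> 'rV[R]_m) mu a :
  (forall k, F (phi_ k)) -> F phi -> (forall w, phi_ k w @[k --> \oo] --> phi w) ->
  (forall k, M (u k)) -> M mu -> u @ \oo --> mu ->
  a < exp_moment P p phi mu ->
  \forall k \near \oo, a < exp_moment P p (phi_ k) (u k).
Proof.
move=> Fphi_ Fphi phi_cvg Mu Mmu umu.
apply: (@fatou_Rintegral _ _ _ P (fun k w => expR (phi_ k w) * p (u k) w)).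
- by move=> k; exact: integrable_exp_moment.
- exact: integrable_exp_moment.
- by move=> k w; rewrite mulr_ge0 ?expR_ge0// ltW// (gos_pos G).
- move=> w; apply: cvgM; last exact: cvg_density.
  exact: (cvg_comp _ _ (phi_cvg w) (@continuous_expR R (phi w))).
Qed.

(** Lower semicontinuity is Fatou's lemma.  For the upper bound, let [v k] be the
    reflection of [u k] through [mu]: midpoint concavity gives
    [E (u k) * E (v k) <= E mu ^+ 2], and lower semicontinuity along [v] turns
    a lower bound of [E (v k)] into an upper bound of [E (u k)]. *)
Lemma exp_moment_continuous phi (u : nat -> 'rV[R]_m) mu : F phi ->
  (forall k, M (u k)) -> M mu -> u @ \oo --> mu ->
  exp_moment P p phi (u k) @[k --> \oo] --> exp_moment P p phi mu.
Proof.
move=> Fphi Mu Mmu umu; set E := exp_moment P p phi.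
have lsc (v : nat -> 'rV[R]_m) a : (forall k, M (v k)) -> v @ \oo --> mu ->
    a < E mu -> \forall k \near \oo, a < E (v k).
  by move=> Mv vmu; apply: (exp_moment_lsc (fun=> phi)) => // w; exact: cvg_cst.
have Emu0 : 0 < E mu := exp_moment_gt0 _ _ Fphi Mmu.
apply/cvgrPdist_lt => e e0.
(* Reflections that fall outside [M], finitely many, are replaced by [mu]. *)
pose v k := if pselect (M (mu + (mu - u k))) then mu + (mu - u k) else mu.
have Mv k : M (v k) by rewrite /v; case: pselect.
have nearM := relint_reflection _ _ Mu Mmu umu.
have vmu : v @ \oo --> mu.
  have := cvg_reflection _ _ umu.
  apply: cvg_trans; apply: near_eq_cvg.
  by apply: filterS nearM => k Mk; rewrite /v; case: pselect.
(* The threshold for which [E (v k) > a] forces [E (u k) < E mu + e]. *)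
pose a := E mu ^+ 2 / (E mu + e).
have Ee0 : 0 < E mu + e by rewrite addr_gt0.
have aE : a < E mu by rewrite /a ltr_pdivrMr// expr2 ltr_pM2l// ltrDl.
have lsc_v := lsc v a Mv vmu aE.
have lsc_u := lsc u (E mu - e) Mu umu.
near=> k.
have Ev : a < E (v k) by near: k.
have vE : v k = mu + (mu - u k).
  have : M (mu + (mu - u k)) by near: k.
  by rewrite /v; case: pselect.
have mid : E (u k) * E (v k) <= E mu ^+ 2.
  apply: exp_moment_midpoint => //.
  by rewrite vE addrCA [u k + _]addrC subrK.
have Eu_lt : E (u k) < E mu + e.
  have a0 : 0 < a by rewrite /a divr_gt0 ?exprn_gt0.
  have Euk0 : 0 < E (u k) := exp_moment_gt0 _ _ Fphi (Mu k).
  rewrite -(ltr_pM2r a0) [ltRHS]mulrC divfK ?gt_eqF//.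
  by apply: lt_le_trans mid; rewrite ltr_pM2l.
have Eu_gt : E mu - e < E (u k).
  by near: k; apply: lsc_u; rewrite ltrBlDr ltrDl.
by rewrite ltr_norml; apply/andP; split; lra.
Unshelve. all: by end_near. Qed.

End observation_scheme.

(** * Joint continuity in the detector and the parameters *)

Section joint_continuity.
Context {R : realType} {Omega : completeMetricType R} {m : nat}
  {P : {sigma_finite_measure set (borelType Omega) -> \bar R}}
  {M : set 'rV[R]_m} {p : 'rV[R]_m -> Omega -> R} {F : set (Omega -> R)}
  (G : good_observation_scheme P p M F).

Let Ffin := gos_F_fin_dim G.

(** Weights that can serve, multiplied by the density, as dominating functions
    in [cvg_Rintegral_dominated].  Exponentials of detectors are such weights,
    and their sums need not be exponentials of detectors. *)
Definition continuous_weight (D : Omega -> R) :=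
  [/\ forall w, 0 <= D w,
      forall mu, M mu -> P.-integrable setT
        (EFin \o (fun w : borelType Omega => D w * p mu w)) &
      forall (u : nat -> 'rV[R]_m) mu, (forall k, M (u k)) -> M mu ->
        u @ \oo --> mu ->
        \int[P]_w (D w * p (u k) w) @[k --> \oo] --> \int[P]_w (D w * p mu w)].

Lemma continuous_weight_expR phi : F phi -> continuous_weight (expR \o phi).
Proof.
move=> Fphi; split => [w|mu Mmu|u mu Mu Mmu umu]; first exact: expR_ge0.
  exact: (integrable_exp_moment G).
exact: (exp_moment_continuous G).
Qed.

Lemma continuous_weightD D1 D2 : continuous_weight D1 -> continuous_weight D2 ->
  continuous_weight (fun w => D1 w + D2 w).
Proof.
move=> [D1_ge0 D1i D1c] [D2_ge0 D2i D2c].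
have mulDp mu : (fun w => (D1 w + D2 w) * p mu w) =
    (fun w => D1 w * p mu w + D2 w * p mu w).
  by apply/funext => w; rewrite mulrDl.
split => [w|mu Mmu|u mu Mu Mmu umu]; first by rewrite addr_ge0.
  rewrite mulDp; exact: (integrableD measurableT (D1i _ Mmu) (D2i _ Mmu)).
have intD nu : M nu -> \int[P]_w ((D1 w + D2 w) * p nu w) =
    \int[P]_w (D1 w * p nu w) + \int[P]_w (D2 w * p nu w).
  by move=> Mnu; rewrite mulDp RintegralD//; [exact: D1i|exact: D2i].
rewrite intD//; under eq_cvg do rewrite intD//.
by apply: cvgD; [exact: D1c|exact: D2c].
Qed.

Lemma continuous_weight_sum I (r : seq I) (D : I -> Omega -> R) :
  (forall i, continuous_weight (D i)) ->
  continuous_weight (fun w => \sum_(i <- r) D i w).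
Proof.
move=> Dw; elim: r => [|i r IH].
  have -> : (fun w => \sum_(i <- [::]) D i w) = (cst 0 : Omega -> R).
    by apply/funext => w; rewrite big_nil.
  have zero mu : (fun w => cst 0 w * p mu w) = cst 0.
    by apply/funext => w; rewrite /= mul0r.
  split => [//|mu _|u mu _ _ _]; first by rewrite zero; exact: integrable0.
  under eq_cvg do rewrite zero.
  by rewrite zero; exact: cvg_cst.
have -> : (fun w => \sum_(j <- i :: r) D j w) =
    (fun w => D i w + \sum_(j <- r) D j w).
  by apply/funext => w; rewrite big_cons.
exact: continuous_weightD.
Qed.

Section coordinates.
Context n (e : 'I_n -> Omega -> R) (eF : range (lincomb e) `<=` F).

Let F_lincomb c : F (lincomb e c).
Proof. by apply: eF; exists c. Qed.

Lemma lincomb_cvg (c_ : nat -> 'rV[R]_n) c w : c_ @ \oo --> c ->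
  lincomb e (c_ k) w @[k --> \oo] --> lincomb e c w.
Proof.
move=> cc; apply: cvg_big => [|i _]; first exact: add_continuous.
apply: cvgM; last exact: cvg_cst.
exact: (cvg_comp _ _ cc (@coord_continuous R 1 n ord0 i c)).
Qed.

(** Once the coordinates of [c_ k] are within 1 of those of [c], the detector with
    coordinates [c_ k] differs from that of [c] by at most the sum of the
    [`|e i|], so its exponential is dominated by the weight obtained from
    [expR_sum_le]. *)
Lemma exp_moment_lincomb_continuous (c_ : nat -> 'rV[R]_n) c
    (u : nat -> 'rV[R]_m) mu : c_ @ \oo --> c ->
  (forall k, M (u k)) -> M mu -> u @ \oo --> mu ->
  exp_moment P p (lincomb e (c_ k)) (u k) @[k --> \oo] -->
  exp_moment P p (lincomb e c) mu.
Proof.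
move=> cc Mu Mmu umu.
have : \forall k \near \oo, forall i, `|c_ k ord0 i - c ord0 i| <= 1.
  apply: filter_forall => i.
  have /cvgrPdist_le/(_ 1 ltr01) :=
    cvg_comp _ _ cc (@coord_continuous R 1 n ord0 i c).
  by apply: filterS => k; rewrite distrC.
move=> [N _ cN].
(* The domination holds from the index [N] on, so the sequences are shifted. *)
rewrite -(cvg_shiftn N).
have {}cN k i : `|c_ (k + N)%N ord0 i - c ord0 i| <= 1.
  by apply: cN => /=; exact: leq_addl.
have {}cc : c_ (k + N)%N @[k --> \oo] --> c by rewrite (cvg_shiftn N).
have {}umu : u (k + N)%N @[k --> \oo] --> mu by rewrite (cvg_shiftn N).
pose D w := expR (lincomb e c w) + \sum_(i < n)
  (expR (lincomb e (c + n%:R *: delta_mx ord0 i) w) +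
   expR (lincomb e (c - n%:R *: delta_mx ord0 i) w)).
have [D0 Di Dc] : continuous_weight D.
  apply: continuous_weightD; first exact: continuous_weight_expR.
  apply: continuous_weight_sum => i.
  by apply: continuous_weightD; exact: continuous_weight_expR.
have lincombDZ a i w : lincomb e (c + a *: delta_mx ord0 i) w =
    lincomb e c w + a * e i w.
  rewrite -[in RHS](lincomb_delta n e i) /lincomb mulr_sumr -big_split/=.
  by apply: eq_bigr => j _; rewrite !mxE mulrDl mulrA.
have domD k w : expR (lincomb e (c_ (k + N)%N) w) <= D w.
  have -> : lincomb e (c_ (k + N)%N) w = lincomb e c w +
      \sum_(i < n) (c_ (k + N)%N ord0 i - c ord0 i) * e i w.
    rewrite /lincomb -big_split/=; apply: eq_bigr => i _.
    by rewrite mulrBl addrC subrK.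
  have -> : D w = expR (lincomb e c w) *
      (1 + \sum_i (expR (n%:R * e i w) + expR (- (n%:R * e i w)))).
    rewrite mulrDr mulr1 mulr_sumr; congr +%R; apply: eq_bigr => i _.
    by rewrite -scaleNr !lincombDZ !expRD mulNr mulrDr.
  rewrite expRD ler_pM2l ?expR_gt0//; apply: expR_sum_le => i.
  rewrite (le_trans (ler_norm _))// normrM ler_piMl//; exact: cN.
have := @cvg_Rintegral_dominated _ _ _ P
    (fun k w => expR (lincomb e (c_ (k + N)%N) w) * p (u (k + N)%N) w)
    (fun k w => D w * p (u (k + N)%N) w)
    (fun w => expR (lincomb e c w) * p mu w) (fun w => D w * p mu w).
apply.
- by move=> k; exact: (integrable_exp_moment G).
- by move=> k; exact: Di.
- exact: (integrable_exp_moment G).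
- exact: Di.
- move=> k w; have p0 : 0 < p (u (k + N)%N) w by exact: (gos_pos G).
  by rewrite mulr_ge0 ?expR_ge0 ?(ltW p0)//= ler_pM2r.
- move=> w; apply: cvgM; last exact: (cvg_density G).
  exact: (cvg_comp _ _ (lincomb_cvg _ _ w cc) (@continuous_expR R _)).
- by move=> w; apply: cvgM; [exact: cvg_cst|exact: (cvg_density G)].
- exact: Dc.
Qed.

Lemma Phi_lincomb_continuous (A : set ('rV[R]_m * 'rV[R]_m)) : A `<=` M `*` M ->
  {within [set: 'rV[R]_n] `*` A, continuous
    (fun z : 'rV[R]_n * ('rV[R]_m * 'rV[R]_m) => Phi P p (lincomb e z.1) z.2)}.
Proof.
move=> AM; apply: within_continuous_seq => u z [_ /AM[Mz1 Mz2]] Au uz.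
have Mu1 k : M (u k).2.1 by have [_ /AM[]] := Au k.
have Mu2 k : M (u k).2.2 by have [_ /AM[]] := Au k.
have u1 : (u k).1 @[k --> \oo] --> z.1.
  by apply: (cvg_comp _ _ uz); exact: cvg_fst.
have u2 : (u k).2 @[k --> \oo] --> z.2.
  by apply: (cvg_comp _ _ uz); exact: cvg_snd.
have u21 : (u k).2.1 @[k --> \oo] --> z.2.1.
  by apply: (cvg_comp _ _ u2); exact: cvg_fst.
have u22 : (u k).2.2 @[k --> \oo] --> z.2.2.
  by apply: (cvg_comp _ _ u2); exact: cvg_snd.
have lincombN c : (fun w => - lincomb e c w) = lincomb e (- c).
  apply/funext => w; rewrite /lincomb -sumrN; apply: eq_bigr => i _.
  by rewrite mxE mulNr.
have ln_cvg (c_ : nat -> 'rV[R]_n) c (v : nat -> 'rV[R]_m) mu : c_ @ \oo --> c ->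
    (forall k, M (v k)) -> M mu -> v @ \oo --> mu ->
    ln (exp_moment P p (lincomb e (c_ k)) (v k)) @[k --> \oo] -->
    ln (exp_moment P p (lincomb e c) mu).
  move=> cc Mv Mmu vmu; apply: cvg_comp.
    exact: exp_moment_lincomb_continuous cc Mv Mmu vmu.
  by apply: continuous_ln; exact: (exp_moment_gt0 G).
rewrite /Phi; apply: cvgD; last exact: (ln_cvg (fun k => (u k).1)).
rewrite lincombN; under eq_cvg do rewrite lincombN.
apply: (ln_cvg (fun k => - (u k).1)) => //; exact: cvgN.
Qed.

End coordinates.
End joint_continuity.

(** * Convexity, concavity and minimisation over detectors *)

Section saddle_function.
Context {R : realType} {Omega : completeMetricType R} {m : nat}
  {P : {sigma_finite_measure set (borelType Omega) -> \bar R}}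
  {M : set 'rV[R]_m} {p : 'rV[R]_m -> Omega -> R} {F : set (Omega -> R)}
  (G : good_observation_scheme P p M F).

Let Ffin := gos_F_fin_dim G.

Lemma ln_exp_moment_convex (t : {i01 R}) phi psi mu : F phi -> F psi -> M mu ->
  ln (exp_moment P p (fun w => t%:num * phi w + (1 - t%:num) * psi w) mu) <=
    t%:num * ln (exp_moment P p phi mu) +
    (1 - t%:num) * ln (exp_moment P p psi mu).
Proof.
move=> Fphi Fpsi Mmu; have p0 w : 0 < p mu w by exact: (gos_pos G).
have mul0 chi w : 0 < expR (chi w) * p mu w by rewrite mulr_gt0 ?expR_gt0.
apply: ln_Rintegral_conv.
- exact: (base_measure_neq0 G _ Mmu).
- exact: (integrable_exp_moment G).
- exact: (integrable_exp_moment G).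
- apply: (integrable_exp_moment G) => //; exact: (finite_dim_space_linear Ffin).
- exact: mul0.
- exact: mul0.
- exact: (mul0 (fun w => t%:num * phi w + (1 - t%:num) * psi w)).
- by move=> w; rewrite !lnM ?posrE ?expR_gt0// !expRK; ring.
Qed.

Lemma Phi_convex xy : (M `*` M) xy ->
  @convex_function R (Omega -> R^o) F (fun phi => Phi P p phi xy).
Proof.
move=> [Mx My] t phi psi /set_mem Fphi /set_mem Fpsi.
rewrite convRE /unstable.onem /Phi.
have -> : (fun w => - (conv t (phi : convex_lmodType (Omega -> R^o)) psi) w) =
    (fun w => t%:num * - phi w + (1 - t%:num) * - psi w).
  apply/funext => w.
  transitivity (- (t%:num * phi w + (1 - t%:num) * psi w)) => //; ring.
have := ln_exp_moment_convex t _ _ _ (finite_dim_spaceN Ffin _ Fphi)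
  (finite_dim_spaceN Ffin _ Fpsi) Mx.
have := ln_exp_moment_convex t _ _ _ Fphi Fpsi My.
have -> : (fun w => t%:num * phi w + (1 - t%:num) * psi w) =
    conv t (phi : convex_lmodType (Omega -> R^o)) psi by [].
move=> Ey Ex; apply: le_trans (lerD Ex Ey) _.
by rewrite !mulrDr addrACA.
Qed.

Lemma Phi_concave phi (A : set ('rV[R]_m * 'rV[R]_m)) : F phi -> A `<=` M `*` M ->
  @concave_function R ('rV[R]_m * 'rV[R]_m)%type A (Phi P p phi).
Proof.
move=> Fphi AM t xy xy' /set_mem/AM[Mx My] /set_mem/AM[Mx' My'].
have := gos_concave G (finite_dim_spaceN Ffin _ Fphi) t (mem_set Mx) (mem_set Mx').
have := gos_concave G Fphi t (mem_set My) (mem_set My').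
rewrite !convRE /unstable.onem /Phi => Ey Ex.
by apply: le_trans (lerD Ex Ey); rewrite !mulrDr addrACA.
Qed.

Lemma PhiD_cst phi xy c : F phi -> (M `*` M) xy ->
  Phi P p (fun w => phi w + c) xy = Phi P p phi xy.
Proof.
move=> Fphi [Mx My]; have FN := finite_dim_spaceN Ffin _ Fphi.
have shiftN : (fun w => - (phi w + c)) = (fun w => - phi w + - c).
  by apply/funext => w; rewrite opprD.
rewrite /Phi shiftN !(exp_momentD_cst G)//.
rewrite !lnM ?posrE ?expR_gt0 ?(exp_moment_gt0 G)// !expRK; ring.
Qed.

Definition half_log_ratio x y (w : Omega) := 2^-1 * ln (p x w / p y w).

(** The Hellinger affinity, that is the integral of [sqrt (p x * p y)].  The
    square root is written with [expR] and [ln], as the exponential moments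
    of the half log-ratio then reduce to it termwise. *)
Definition affinity x y := \int[P]_w expR (2^-1 * (ln (p x w) + ln (p y w))).

Lemma half_log_ratio_in x y : M x -> M y -> F (half_log_ratio x y).
Proof. by move=> Mx My; apply: (finite_dim_spaceZ Ffin); exact: (gos_F_ln G). Qed.

Lemma half_log_ratioB x y w : M x -> M y ->
  half_log_ratio x y w = 2^-1 * (ln (p x w) - ln (p y w)).
Proof. by move=> Mx My; rewrite /half_log_ratio ln_div// posrE (gos_pos G). Qed.

Lemma expR_half_log_ratio x y w : M x -> M y ->
  expR (half_log_ratio x y w) * p y w = expR (2^-1 * (ln (p x w) + ln (p y w))).
Proof.
move=> Mx My; rewrite half_log_ratioB// -[X in _ * X]lnK ?posrE ?(gos_pos G)//.
by rewrite -expRD; congr expR; field.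
Qed.

Lemma expR_half_log_ratioN x y w : M x -> M y ->
  expR (- half_log_ratio x y w) * p x w = expR (2^-1 * (ln (p x w) + ln (p y w))).
Proof.
move=> Mx My; rewrite half_log_ratioB// -[X in _ * X]lnK ?posrE ?(gos_pos G)//.
by rewrite -expRD; congr expR; field.
Qed.

Lemma integrable_affinity x y : M x -> M y ->
  P.-integrable setT (EFin \o
    (fun w : borelType Omega => expR (2^-1 * (ln (p x w) + ln (p y w))))).
Proof.
move=> Mx My; have := integrable_exp_moment G _ _ (half_log_ratio_in x y Mx My) My.
by congr integrable; apply/funext => w /=; rewrite expR_half_log_ratio.
Qed.

Lemma affinity_gt0 x y : M x -> M y -> 0 < affinity x y.
Proof.
move=> Mx My; apply: Rintegral_gt0; first exact: (base_measure_neq0 G _ Mx).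
  exact: integrable_affinity.
by move=> w; rewrite expR_gt0.
Qed.

Lemma Phi_half_log_ratio x y : M x -> M y ->
  Phi P p (half_log_ratio x y) (x, y) = 2 * ln (affinity x y).
Proof.
move=> Mx My; rewrite /Phi /exp_moment /affinity/=.
under eq_Rintegral do rewrite expR_half_log_ratioN//.
rewrite mulr_natl mulr2n; congr (_ + ln _).
by apply: eq_Rintegral => w _; rewrite expR_half_log_ratio.
Qed.

Let half01 : 0 <= (2^-1 : R) <= 1. Proof. lra. Qed.
Let half : {i01 R} := Itv01 (andP half01).1 (andP half01).2.

(** The Cauchy-Schwarz inequality, since [expR (- phi) * p x] and
    [expR phi * p y] have product [p x * p y] whatever [phi] is. *)
Lemma Phi_ge_affinity phi x y : F phi -> M x -> M y ->
  2 * ln (affinity x y) <= Phi P p phi (x, y).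
Proof.
move=> Fphi Mx My.
have FN := finite_dim_spaceN Ffin _ Fphi.
have px w : 0 < p x w by exact: (gos_pos G).
have py w : 0 < p y w by exact: (gos_pos G).
have := @ln_Rintegral_conv _ _ _ P (fun w => expR (- phi w) * p x w)
  (fun w => expR (phi w) * p y w)
  (fun w => expR (2^-1 * (ln (p x w) + ln (p y w)))) half.
rewrite /= => holder; rewrite /Phi /=.
suff : ln (affinity x y) <= 2^-1 * ln (exp_moment P p (fun w => - phi w) x) +
    (1 - 2^-1) * ln (exp_moment P p phi y) by lra.
apply: holder.
- exact: (base_measure_neq0 G _ Mx).
- exact: (integrable_exp_moment G).
- exact: (integrable_exp_moment G).
- exact: integrable_affinity.
- by move=> w; rewrite mulr_gt0 ?expR_gt0.
- by move=> w; rewrite mulr_gt0 ?expR_gt0.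
- by move=> w; rewrite expR_gt0.
- by move=> w; rewrite !lnM ?posrE ?expR_gt0// !expRK; field.
Qed.

Lemma cvg_ln_density (u : nat -> 'rV[R]_m) mu w : (forall k, M (u k)) -> M mu ->
  u @ \oo --> mu -> ln (p (u k) w) @[k --> \oo] --> ln (p mu w).
Proof.
move=> Mu Mmu umu; apply: cvg_comp; first exact: (cvg_density G _ _ w Mu Mmu umu).
by apply: continuous_ln; exact: (gos_pos G).
Qed.

(** By the arithmetic-geometric inequality the integrand is dominated by
    [p x + p y], the integral of which is 2 for all parameters. *)
Lemma affinity_continuous (A : set ('rV[R]_m * 'rV[R]_m)) : A `<=` M `*` M ->
  {within A, continuous (fun xy => affinity xy.1 xy.2)}.
Proof.
move=> AM; apply: within_continuous_seq => u z /AM[Mz1 Mz2] Au uz.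
have Mu1 k : M (u k).1 by have /AM[] := Au k.
have Mu2 k : M (u k).2 by have /AM[] := Au k.
have u1 : (u k).1 @[k --> \oo] --> z.1.
  by apply: (cvg_comp _ _ uz); exact: cvg_fst.
have u2 : (u k).2 @[k --> \oo] --> z.2.
  by apply: (cvg_comp _ _ uz); exact: cvg_snd.
have int_sum x y : M x -> M y -> \int[P]_w (p x w + p y w) = 2.
  move=> Mx My; rewrite RintegralD//; [|exact: (integrable_density G)..].
  by rewrite !(Rintegral_density G)// -[2]/(1 + 1).
have sumi x y : M x -> M y -> P.-integrable setT
    (EFin \o (fun w : borelType Omega => p x w + p y w)).
  move=> Mx My; exact: (integrableD measurableT (integrable_density G _ Mx)
    (integrable_density G _ My)).
have := @cvg_Rintegral_dominated _ _ _ P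
  (fun k w => expR (2^-1 * (ln (p (u k).1 w) + ln (p (u k).2 w))))
  (fun k w => p (u k).1 w + p (u k).2 w)
  (fun w => expR (2^-1 * (ln (p z.1 w) + ln (p z.2 w))))
  (fun w => p z.1 w + p z.2 w).
apply.
- by move=> k; exact: integrable_affinity.
- by move=> k; exact: sumi.
- exact: integrable_affinity.
- exact: sumi.
- move=> k w; rewrite expR_ge0/=.
  have px : 0 < p (u k).1 w by exact: (gos_pos G).
  have py : 0 < p (u k).2 w by exact: (gos_pos G).
  have := convex_expR half (ln (p (u k).1 w)) (ln (p (u k).2 w)).
  rewrite !convRE/= /unstable.onem !lnK ?posrE//.
  have -> : 1 - 2^-1 = 2^-1 :> R by lra.
  by rewrite -mulrDr; lra.
- move=> w; have ln_cvg : 2^-1 * (ln (p (u k).1 w) + ln (p (u k).2 w)) @[k --> \oo]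
      --> 2^-1 * (ln (p z.1 w) + ln (p z.2 w)).
    apply: cvgM; first exact: cvg_cst.
    by apply: cvgD; exact: cvg_ln_density.
  exact: (cvg_comp _ _ ln_cvg (@continuous_expR R _)).
- by move=> w; apply: cvgD; exact: (cvg_density G).
- rewrite int_sum//; under eq_cvg do rewrite int_sum//.
  exact: cvg_cst.
Qed.

End saddle_function.

Arguments half_log_ratio {R Omega m} p x y w.
Arguments affinity {R Omega m} P p x y.

(** * Saddle points *)

Lemma saddle_point_minmax_value {R : realType} {U V : Type} (A : set U) (B : set V)
    (f : U -> V -> R) u v :
  (forall u', A u' -> exists c, maximums [set f u' v' | v' in B] c) ->
  saddle_point A B f u v -> minmax_value A B f (f u v).
Proof.
move=> maxf [Au Bv fmin fmax].
have maxA u' : exists c, A u' -> maximums [set f u' v' | v' in B] c.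
  have [Au'|nAu'] := pselect (A u'); last by exists 0.
  by have [c cP] := maxf u' Au'; exists c.
have [g gP] := choice maxA.
exists g; split => //; split.
  exists u => //; have [[v' Bv' <-] gmax] := gP u Au.
  by apply/eqP; rewrite eq_le fmax//=; apply: gmax; exists v.
move=> _ [u' Au' <-]; apply: le_trans (fmin u' Au') _.
by have [_ gmax] := gP u' Au'; apply: gmax; exists v.
Qed.

Lemma le_ln {R : realType} (a b : R) : 0 < a -> a <= b -> ln a <= ln b.
Proof. by move=> a0 ab; rewrite ler_ln ?posrE// (lt_le_trans a0). Qed.

Lemma lt_half_gapD {R : realType} (a b a' b' v : R) :
  a - (a + b - v) / 2 < a' -> b - (a + b - v) / 2 < b' -> v < a' + b'.
Proof. lra. Qed.

Lemma conv_le_cancel {R : realType} (s a b c v : R) :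
  s * a + (1 - s) * b <= c -> v <= b -> 0 < s <= 1 -> c <= v -> a <= v.
Proof.
move=> abc vb /andP[s0 s1] cv; rewrite -(ler_pM2l s0).
have : (1 - s) * v <= (1 - s) * b by rewrite ler_wpM2l// subr_ge0.
lra.
Qed.

Section saddle_points_and_tests.
Context {R : realType} {Omega : completeMetricType R} {m : nat}
  {P : {sigma_finite_measure set (borelType Omega) -> \bar R}}
  {M : set 'rV[R]_m} {p : 'rV[R]_m -> Omega -> R} {F : set (Omega -> R)}
  (G : good_observation_scheme P p M F).

Let Ffin := gos_F_fin_dim G.

(** At a maximiser [(x, y)] of the affinity, the half log-ratio minimises [Phi] by
    [Phi_ge_affinity].  That [(x, y)] maximises [Phi] for this detector is the
    differentiation of a minimum along segments: the bound holds for the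
    optimal detectors at the points of the segment near [(x, y)], and passes to
    the limit by lower semicontinuity. *)
Lemma saddle_point_exists (X Y : set 'rV[R]_m) :
  X !=set0 -> X `<=` M -> convex_set X -> compact X ->
  Y !=set0 -> Y `<=` M -> convex_set Y -> compact Y ->
  exists phi x y, saddle_point F (X `*` Y) (Phi P p) phi (x, y).
Proof.
move=> [x0 Xx0] XM Xconv Xcomp [y0 Yy0] YM Yconv Ycomp.
have XYM : X `*` Y `<=` M `*` M by move=> z [/XM Mz1 /YM Mz2].
have [[x y] /set_mem[/= Xx Yy] xy_max] : exists2 c, c \in X `*` Y &
    forall t, t \in X `*` Y ->
      affinity P p t.1 t.2 <= affinity P p c.1 c.2.
  apply: compact_EVT_max; [by exists (x0, y0)|exact: compact_setX|].
  exact: (affinity_continuous G).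
have [Mx My] : M x /\ M y by split; [exact: XM|exact: YM].
exists (half_log_ratio p x y), x, y.
have [V VE] : exists V, V = 2 * ln (affinity P p x y) by eexists.
have PhiV : Phi P p (half_log_ratio p x y) (x, y) = V.
  by rewrite VE; exact: (Phi_half_log_ratio G x y Mx My).
have V_le phi : F phi -> V <= Phi P p phi (x, y).
  by rewrite VE => Fphi; exact: (Phi_ge_affinity G phi x y Fphi Mx My).
split; [exact: (half_log_ratio_in G)|by split|by rewrite PhiV|rewrite PhiV].
move=> [x' y'] [/= Xx' Yy'].
have [Mx' My'] : M x' /\ M y' by split; [exact: XM|exact: YM].
have t01 (k : nat) : 0 <= (k.+1%:R^-1 : R) <= 1.
  by rewrite invr_ge0 ler0n/= invf_le1 ?ltr0n// ler1n.
pose t k : {i01 R} := Itv01 (andP (t01 k)).1 (andP (t01 k)).2.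
pose xt k : 'rV[R]_m := conv (t k) (x' : convex_lmodType 'rV[R]_m) x.
pose yt k : 'rV[R]_m := conv (t k) (y' : convex_lmodType 'rV[R]_m) y.
have Xxt k : X (xt k) by apply: set_mem; apply: Xconv; exact: mem_set.
have Yyt k : Y (yt k) by apply: set_mem; apply: Yconv; exact: mem_set.
have Mxt k : M (xt k) := XM _ (Xxt k).
have Myt k : M (yt k) := YM _ (Yyt k).
pose psi k := half_log_ratio p (xt k) (yt k).
have Fpsi k : F (psi k) := half_log_ratio_in G _ _ (Mxt k) (Myt k).
have psi_le k : Phi P p (psi k) (x', y') <= V.
  have := Phi_concave G (psi k) _ (Fpsi k) XYM (t k) (x', y') (x, y)
    (mem_set (conj Xx' Yy')) (mem_set (conj Xx Yy)).
  rewrite convRE /unstable.onem/=.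
  have -> : conv (t k) ((x', y') : convex_lmodType ('rV[R]_m * 'rV[R]_m)%type)
    (x, y) = (xt k, yt k) by [].
  rewrite (Phi_half_log_ratio G (xt k) (yt k) (Mxt k) (Myt k)) => le_aff.
  apply: (conv_le_cancel _ _ _ _ _ le_aff (V_le _ (Fpsi k))).
    by rewrite invr_gt0 ltr0n/= invf_le1 ?ltr0n// ler1n.
  have aff_gt0 u v : M u -> M v -> 0 < affinity P p u v by exact: (affinity_gt0 G).
  rewrite VE; apply: (ler_wpM2l (ler0n R 2)).
  apply: (le_ln _ _ (aff_gt0 _ _ (Mxt k) (Myt k))).
  exact: (xy_max (xt k, yt k) (mem_set (conj (Xxt k) (Yyt k)))).
have conv_cvg (v v' : 'rV[R]_m) :
    (conv (t k) (v' : convex_lmodType 'rV[R]_m) v : 'rV[R]_m) @[k --> \oo] --> v.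
  have t0 : (k.+1%:R^-1 : R) @[k --> \oo] --> (0 : R) by exact: cvg_harmonic.
  have : k.+1%:R^-1 *: v' + (1 - k.+1%:R^-1) *: v @[k --> \oo] -->
      0 *: v' + (1 - 0) *: v.
    apply: cvgD; first by apply: cvgZ; [exact: t0|exact: cvg_cst].
    apply: cvgZ; last exact: cvg_cst.
    by apply: cvgB; [exact: cvg_cst|exact: t0].
  by rewrite scale0r add0r subr0 scale1r.
have psi_cvg w : psi k w @[k --> \oo] --> half_log_ratio p x y w.
  rewrite (half_log_ratioB G)//; under eq_cvg do rewrite /psi (half_log_ratioB G)//.
  apply: cvgM; first exact: cvg_cst.
  by apply: cvgB; apply: (cvg_ln_density G) => //; exact: conv_cvg.
set phi := half_log_ratio p x y in psi_cvg *.
have Fphi : F phi by exact: (half_log_ratio_in G).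
(* Fatou's lemma applies to each exponential moment, whereas [Phi] is a sum of
   two logarithms: each of these may lose half of the excess over [V]. *)
rewrite leNgt; apply/negP => PhiV'.
pose d := (Phi P p phi (x', y') - V) / 2.
have d0 : 0 < d by rewrite divr_gt0// subr_gt0.
have lsc chi_ chi mu : (forall k, F (chi_ k)) -> F chi -> M mu ->
    (forall w, chi_ k w @[k --> \oo] --> chi w) ->
    \forall k \near \oo, ln (exp_moment P p chi mu) - d <
      ln (exp_moment P p (chi_ k) mu).
  move=> Fchi_ Fchi Mmu chi_cvg.
  have E0 := exp_moment_gt0 G _ _ Fchi Mmu.
  have : expR (ln (exp_moment P p chi mu) - d) < exp_moment P p chi mu.
    by rewrite -[ltRHS]lnK ?posrE// ltr_expR ltrBlDr ltrDl.
  move=> /(exp_moment_lsc G chi_ chi (fun=> mu) mu _ Fchi_ Fchi chi_cvg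
    (fun=> Mmu) Mmu (cvg_cst mu)).
  apply: filterS => k Ek; rewrite -ltr_expR.
  by rewrite [ltRHS](lnK (exp_moment_gt0 G _ _ (Fchi_ k) Mmu)).
have near_y := lsc psi phi y' Fpsi Fphi My' psi_cvg.
have near_x := lsc (fun k w => - psi k w) (fun w => - phi w) x'
  (fun k => finite_dim_spaceN Ffin _ (Fpsi k)) (finite_dim_spaceN Ffin _ Fphi) Mx'
  (fun w => cvgN (psi_cvg w)).
have [k [ky kx]] := filter_ex (filterI near_y (near_x _)).
have := lt_half_gapD _ _ _ _ _ kx ky.
by rewrite ltNge => /negP; apply; exact: psi_le.
Qed.

(** * Uniqueness of the optimal detector *)

(** The hypotheses force equality in the Cauchy-Schwarz inequality: the squared
    difference of [sqrt (expR (- phi) * p x)] and [sqrt (expR phi * p y)] has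
    nonpositive integral.  These functions thus agree almost everywhere, that is
    [phi] is the half log-ratio outside a null set; this set is open by
    continuity, hence empty because [P] has full support. *)
Lemma saddle_detector phi x y eps : F phi -> M x -> M y ->
  exp_moment P p (fun w => - phi w) x = eps -> exp_moment P p phi y = eps ->
  Phi P p phi (x, y) <= 2 * ln (affinity P p x y) ->
  phi = half_log_ratio p x y.
Proof.
move=> Fphi Mx My Ex Ey Phi_le.
have FN := finite_dim_spaceN Ffin _ Fphi.
have eps0 : 0 < eps by rewrite -Ey; exact: (exp_moment_gt0 G).
have eps_le : eps <= affinity P p x y.
  rewrite -ler_ln ?posrE ?(affinity_gt0 G)//.
  by move: Phi_le; rewrite /Phi/= Ex Ey; lra.
have px w : 0 < p x w by exact: (gos_pos G).
have py w : 0 < p y w by exact: (gos_pos G).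
pose a w := expR (2^-1 * (ln (p x w) - phi w)).
pose b w := expR (2^-1 * (ln (p y w) + phi w)).
pose f w := (a w - b w) ^+ 2.
have fE : f = (fun w => expR (- phi w) * p x w + expR (phi w) * p y w -
    2 * expR (2^-1 * (ln (p x w) + ln (p y w)))).
  apply/funext => w.
  have aa : a w * a w = expR (- phi w) * p x w.
    by rewrite -[p x w in RHS]lnK ?posrE// -!expRD; congr expR; field.
  have bb : b w * b w = expR (phi w) * p y w.
    by rewrite -[p y w in RHS]lnK ?posrE// -!expRD; congr expR; field.
  have ab : a w * b w = expR (2^-1 * (ln (p x w) + ln (p y w))).
    by rewrite -expRD; congr expR; field.
  by rewrite -aa -bb -ab /f; ring.
have ix := integrable_exp_moment G _ _ FN Mx.
have iy := integrable_exp_moment G _ _ Fphi My.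
have ixy := integrable_affinity G _ _ Mx My.
have ixyD := integrableD measurableT ix iy.
have ixy2 := integrableZl measurableT 2 ixy.
have fi : P.-integrable setT (EFin \o (f : borelType Omega -> R)).
  by rewrite fE; exact: (integrableB measurableT ixyD ixy2).
have If : \int[P]_w f w <= 0.
  rewrite fE RintegralB// RintegralD// RintegralZl//.
  by move: Ex Ey eps_le; rewrite /exp_moment /affinity => -> ->; lra.
pose D : set Omega := [set w | phi w - half_log_ratio p x y w != 0].
have oD : open D.
  have Fdiff : F (fun w => phi w - half_log_ratio p x y w).
    apply: (finite_dim_spaceD Ffin _ _ Fphi); apply: (finite_dim_spaceN Ffin).
    exact: (half_log_ratio_in G).
  apply: (open_comp _ (@open_neq R 0)) => w _; exact: (gos_F_cont G Fdiff).
have mD : measurable (D : set (borelType Omega)) by exact: sub_sigma_algebra.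
have PD : P D = 0%E.
  apply: (@Rintegral_le0_null _ _ _ P f D) => // [w|w Dw].
    by rewrite /f sqr_ge0.
  rewrite /f exprn_even_gt0//= subr_eq0; apply: contra Dw => /eqP/expR_inj ab.
  by rewrite (half_log_ratioB G)//; apply/eqP; lra.
apply/funext => w; apply/eqP; rewrite -subr_eq0; apply: contrapT => /negP Dw.
have : measure_support P w by rewrite (gos_support G).
by move=> /(_ D (conj oD Dw)); rewrite PD ltxx.
Qed.

(** * Error probabilities of tests *)

Lemma measurable_detector_ge0 phi : F phi ->
  measurable ([set w | 0 <= phi w] : set (borelType Omega)).
Proof.
move=> Fphi; rewrite -[X in measurable X]setCK; apply: measurableC.
apply: sub_sigma_algebra.
have -> : ~` [set w | 0 <= phi w] = phi @^-1` [set r | r < 0].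
  by apply/seteqP; split => w /=; rewrite ltNge => /negP.
by apply: open_comp => [w _|]; [exact: (gos_F_cont G)|exact: open_lt].
Qed.

(** Markov's inequality: [1 <= expR (phi w)] on [A]. *)
Lemma Pr_ge0_le phi mu (A : set Omega) : F phi -> M mu ->
  measurable (A : set (borelType Omega)) -> (forall w, A w -> 0 <= phi w) ->
  (Pr P p mu A <= (exp_moment P p phi mu)%:E)%E.
Proof.
move=> Fphi Mmu mA Aphi.
have iphi := integrable_exp_moment G _ _ Fphi Mmu.
have mphi := measurable_int _ iphi.
have mp := measurable_int _ (integrable_density G _ Mmu).
have p0 w : 0 < p mu w by exact: (gos_pos G).
have ge0 w : 0 <= expR (phi w) * p mu w by rewrite mulr_ge0 ?expR_ge0// ltW.
rewrite /Pr /exp_moment -(fin_Rintegral _ iphi).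
apply: (@le_trans _ _ (\int[P]_(w in A) (expR (phi w) * p mu w)%:E)%E).
  apply: ge0_le_integral => //.
  - by move=> w _; rewrite lee_fin ltW.
  - exact: measurable_funTS mp.
  - exact: measurable_funTS mphi.
  - move=> w Aw; rewrite lee_fin ler_peMl ?(ltW (p0 w))//.
    by rewrite -[leLHS]expR0 ler_expR Aphi.
by apply: ge0_subset_integral => // w _; rewrite lee_fin.
Qed.

Lemma error_Y_simple_test (Y : set 'rV[R]_m) phi c : F phi -> Y `<=` M ->
  (forall y, Y y -> exp_moment P p phi y <= c) ->
  (error_Y P p Y (simple_test phi) <= c%:E)%E.
Proof.
move=> Fphi YM Ec; apply: ge_ereal_sup => _ [y Yy <-].
have -> : [set w | simple_test phi w = 1] = [set w | 0 <= phi w].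
  apply/seteqP; split => w /=; rewrite /simple_test; case: ifP => // _.
  by move=> /eqP; rewrite eq_sym -subr_eq0 opprK (_ : 1 + 1 = 2%:R)// pnatr_eq0.
apply: (@le_trans _ _ (exp_moment P p phi y)%:E); last by rewrite lee_fin Ec.
by apply: Pr_ge0_le => //; [exact: YM|exact: measurable_detector_ge0].
Qed.

Lemma error_X_simple_test (X : set 'rV[R]_m) phi c : F phi -> X `<=` M ->
  (forall x, X x -> exp_moment P p (fun w => - phi w) x <= c) ->
  (error_X P p X (simple_test phi) <= c%:E)%E.
Proof.
move=> Fphi XM Ec; apply: ge_ereal_sup => _ [x Xx <-].
have -> : [set w | simple_test phi w = -1] = ~` [set w | 0 <= phi w].
  apply/seteqP; split => w /=; rewrite /simple_test; case: ifP => // _.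
  by move=> /eqP; rewrite -subr_eq0 opprK (_ : 1 + 1 = 2%:R)// pnatr_eq0.
apply: (@le_trans _ _ (exp_moment P p (fun w => - phi w) x)%:E); last first.
  by rewrite lee_fin Ec.
apply: Pr_ge0_le; [exact: (finite_dim_spaceN Ffin)|exact: XM| |].
- by apply: measurableC; exact: measurable_detector_ge0.
- by move=> w /= /negP; rewrite -ltNge oppr_ge0 => /ltW.
Qed.

(** With [I] the integral of [min (p x, p y)], the Cauchy-Schwarz inequality for
    the minimum and the maximum of the densities bounds the squared affinity by
    [I * (2 - I)].  Bounding the minimum by [p x] where the test rejects the
    first hypothesis and by [p y] where it accepts it gives [I <= delta], and
    [I * (2 - I)] increases with [I] up to 1. *)
Lemma affinity_sqr_le x y (T : borelType Omega -> R) (delta : R) :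
  M x -> M y -> is_test T -> delta <= 1 ->
  (Pr P p x [set w | T w = (-1)%R] + Pr P p y [set w | T w = 1%R] <= delta%:E)%E ->
  affinity P p x y ^+ 2 <= delta * (2 - delta).
Proof.
move=> Mx My [mT T1] delta1 err.
have px w : 0 < p x w by exact: (gos_pos G).
have py w : 0 < p y w by exact: (gos_pos G).
have ipx := integrable_density G _ Mx.
have ipy := integrable_density G _ My.
pose mn (w : borelType Omega) := Num.min (p x w) (p y w).
pose mx (w : borelType Omega) := Num.max (p x w) (p y w).
have mn0 w : 0 < mn w by rewrite /mn lt_min px py.
have imn : P.-integrable setT (EFin \o mn).
  apply: (integrable_le (p x : borelType Omega -> R)) => //.
    apply: measurable_minr; first exact: (integrable_measurableR ipx).
    exact: (integrable_measurableR ipy).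
  by move=> w; rewrite (ltW (mn0 w))/= /mn ge_min lexx.
have mxE : mx = (fun w => p x w + p y w - mn w).
  by apply/funext => w; rewrite /mx maxr_to_min.
have ipxy := integrableD measurableT ipx ipy.
have imx : P.-integrable setT (EFin \o mx).
  by rewrite mxE; exact: (integrableB measurableT ipxy imn).
set I := \int[P]_w mn w.
have Imx : \int[P]_w mx w = 2 - I.
  rewrite mxE RintegralB// RintegralD//.
  by rewrite (Rintegral_density G)// (Rintegral_density G)//.
have I0 : 0 < I by apply: Rintegral_gt0 => //; exact: (base_measure_neq0 G _ Mx).
have Imx0 : 0 < 2 - I.
  rewrite -Imx; apply: Rintegral_gt0 => //; first exact: (base_measure_neq0 G _ Mx).
  by move=> w; rewrite /mx lt_max px.
have I_le : I <= delta.
  rewrite -lee_fin -(fin_Rintegral _ imn); apply: le_trans err.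
  pose A := [set w | T w = -1]; pose B := [set w | T w = 1].
  have mA : measurable A.
    by have := mT measurableT [set -1] (measurable_set1 _); rewrite setTI.
  have mB : measurable B.
    by have := mT measurableT [set 1] (measurable_set1 _); rewrite setTI.
  have AB : [set: borelType Omega] = A `|` B.
    by apply/seteqP; split => w // _; have [] := T1 w; [right|left].
  rewrite AB ge0_integral_setU//.
  - apply: leeD; apply: ge0_le_integral => //.
    + by move=> w _; rewrite lee_fin ltW.
    + exact: measurable_funTS (measurable_int _ imn).
    + exact: measurable_funTS (measurable_int _ ipx).
    + by move=> w _; rewrite lee_fin /mn ge_min lexx.
    + by move=> w _; rewrite lee_fin ltW.
    + exact: measurable_funTS (measurable_int _ imn).
    + exact: measurable_funTS (measurable_int _ ipy).
    + by move=> w _; rewrite lee_fin /mn ge_min lexx orbT.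
  - exact: measurable_funTS (measurable_int _ imn).
  - by move=> w _; rewrite lee_fin ltW.
  - apply/disj_setPS => w [/= Tw]; rewrite /B/= Tw => /eqP.
    by rewrite eq_sym -subr_eq0 opprK (_ : 1 + 1 = 2%:R)// pnatr_eq0.
have half01 : 0 <= (2^-1 : R) <= 1 by lra.
have := @ln_Rintegral_conv _ _ _ P mn mx
  (fun w => expR (2^-1 * (ln (p x w) + ln (p y w))))
  (Itv01 (andP half01).1 (andP half01).2).
move=> /(_ (base_measure_neq0 G _ Mx) imn imx (integrable_affinity G _ _ Mx My) mn0).
rewrite /= Imx -/I -/(affinity P p x y) => ln_le.
have {}ln_le : ln (affinity P p x y) <= 2^-1 * ln I + (1 - 2^-1) * ln (2 - I).
  apply: ln_le => w; rewrite ?expR_gt0 /mx ?lt_max ?px// expRK /mn.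
  by case: (leP (p x w) (p y w)) => _; field.
have affI : affinity P p x y ^+ 2 <= I * (2 - I).
  have aff0 : 0 < affinity P p x y by exact: (affinity_gt0 G).
  rewrite -ler_ln ?posrE ?exprn_gt0 ?mulr_gt0//.
  rewrite (lnM (aff0 : _ \is Num.pos) aff0) (lnM I0 Imx0).
  by move: ln_le; lra.
apply: le_trans affI _; nra.
Qed.

(** * Attainment of the inner maximum *)

(** [Phi P p phi] is the sum of a function of [x] and a function of [y], which can
    be maximised separately. *)
Lemma Phi_max_attained (X Y : set 'rV[R]_m) phi : F phi ->
  X !=set0 -> X `<=` M -> compact X -> Y !=set0 -> Y `<=` M -> compact Y ->
  exists c, maximums [set Phi P p phi z | z in X `*` Y] c.
Proof.
move=> Fphi X0 XM Xcomp Y0 YM Ycomp.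
have max_on (A : set 'rV[R]_m) chi : F chi -> A !=set0 -> A `<=` M -> compact A ->
    exists2 c, A c & forall v, A v ->
      ln (exp_moment P p chi v) <= ln (exp_moment P p chi c).
  move=> Fchi A0 AM Acomp.
  have [|c /set_mem Ac cmax] := compact_EVT_max (f := exp_moment P p chi) A0 Acomp.
    apply: within_continuous_seq => u z Az Au uz.
    by apply: (exp_moment_continuous G) => // [k|]; exact: AM.
  exists c => // v Av; rewrite ler_ln ?posrE; first exact/cmax/mem_set.
    by apply: (exp_moment_gt0 G) => //; exact: AM.
  by apply: (exp_moment_gt0 G) => //; exact: AM.
have [x Xx xmax] := max_on X _ (finite_dim_spaceN Ffin _ Fphi) X0 XM Xcomp.
have [y Yy ymax] := max_on Y _ Fphi Y0 YM Ycomp.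
exists (Phi P p phi (x, y)); split; first by exists (x, y).
move=> _ [[x' y'] [/= Xx' Yy'] <-]; rewrite /Phi/=.
by apply: lerD; [exact: xmax|exact: ymax].
Qed.

End saddle_points_and_tests.

(** * Detectors given by saddle points *)

Theorem theorem2p1 (R : realType) (Omega : completeMetricType R) (m : nat)
    (P : {sigma_finite_measure set (borelType Omega) -> \bar R})
    (M : set 'rV[R]_m) (p : 'rV[R]_m -> Omega -> R) (F : set (Omega -> R))
    (X Y : set 'rV[R]_m)
    (hGOS : good_observation_scheme P p M F)
    (hX0 : X !=set0) (hXM : X `<=` M) (hXconv : convex_set X)
    (hXcomp : compact X)
    (hY0 : Y !=set0) (hYM : Y `<=` M) (hYconv : convex_set Y)
    (hYcomp : compact Y) :
  [/\ forall (n : nat) (e : 'I_n -> Omega -> R), basis_of_space e F ->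
        {within [set: 'rV[R]_n] `*` (X `*` Y), continuous
          (fun z : 'rV[R]_n * ('rV[R]_m * 'rV[R]_m) =>
             Phi P p (lincomb e z.1) z.2)},
      forall xy, (X `*` Y) xy ->
        @convex_function R (Omega -> R^o) F (fun phi => Phi P p phi xy),
      forall phi, F phi ->
        @concave_function R ('rV[R]_m * 'rV[R]_m)%type (X `*` Y)
          (Phi P p phi) &
      exists (phi : Omega -> R) (x y : 'rV[R]_m),
        saddle_point F (X `*` Y) (Phi P p) phi (x, y)] /\
  (forall (phi : Omega -> R) (x y : 'rV[R]_m),
     saddle_point F (X `*` Y) (Phi P p) phi (x, y) ->
     (forall c : R,
        saddle_point F (X `*` Y) (Phi P p) (fun w => phi w + c) (x, y)) /\
     (exists c : R,
        exp_moment P p (fun w => - (phi w + c)) x =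
        exp_moment P p (fun w => phi w + c) y)) /\
  (forall (phi : Omega -> R) (x y : 'rV[R]_m) (eps : R),
     saddle_point F (X `*` Y) (Phi P p) phi (x, y) ->
     exp_moment P p (fun w => - phi w) x = eps ->
     exp_moment P p phi y = eps ->
     [/\ Phi P p phi (x, y) = 2 * ln eps /\
           minmax_value F (X `*` Y) (Phi P p) (2 * ln eps),
         (risk P p X Y (simple_test phi) <= eps%:E)%E,
         forall a : R,
           (error_X P p X (simple_test (fun w => (phi w - a)%R)) <=
             (expR a * eps)%:E)%E /\
           (error_Y P p Y (simple_test (fun w => (phi w - a)%R)) <=
             (expR (- a) * eps)%:E)%E,
         forall epsilon : R, 0 <= epsilon -> epsilon <= 2^-1 ->
           (exists T : borelType Omega -> R, is_test T /\
              (Pr P p x [set w | T w = (-1)%R] + Pr P p y [set w | T w = 1%R]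
                <= (2 * epsilon)%:E)%E) ->
           eps <= 2 * Num.sqrt (epsilon * (1 - epsilon)) /\
           (risk P p X Y (simple_test phi) <=
             (2 * Num.sqrt (epsilon * (1 - epsilon)))%:E)%E &
         forall w : Omega, phi w = 2^-1 * ln (p x w / p y w)]).
Proof.
have Ffin := gos_F_fin_dim hGOS.
have XYM : X `*` Y `<=` M `*` M by move=> z [/hXM Mz1 /hYM Mz2].
have Fcst phi c : F phi -> F (fun w => phi w + c).
  move=> Fphi; apply: (finite_dim_spaceD Ffin _ (cst c) Fphi).
  exact: (gos_F_cst hGOS).
split; last split.
- split.
  + move=> n e [_ eF]; apply: (Phi_lincomb_continuous hGOS) XYM.
    by rewrite eF.
  + by move=> xy /XYM Mxy; exact: (Phi_convex hGOS).
  + by move=> phi Fphi; exact: (Phi_concave hGOS).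
  + exact: (saddle_point_exists hGOS).
- move=> phi x y [Fphi [/= Xx Yy] phi_min xy_max].
  have Mx := hXM _ Xx; have My := hYM _ Yy.
  have FN := finite_dim_spaceN Ffin _ Fphi.
  split => [c|].
    have PhiDc z : (X `*` Y) z -> Phi P p (fun w => phi w + c) z = Phi P p phi z.
      by move=> /XYM Mz; exact: (PhiD_cst hGOS phi z c Fphi Mz).
    have XYxy : (X `*` Y) (x, y) by split.
    split; [exact: Fcst|exact: XYxy| |].
      by move=> psi Fpsi; rewrite (PhiDc _ XYxy); exact: phi_min.
    by move=> z XYz; rewrite (PhiDc _ XYxy) (PhiDc _ XYz); exact: xy_max.
  set A := exp_moment P p (fun w => - phi w) x; set B := exp_moment P p phi y.
  have A0 : 0 < A by exact: (exp_moment_gt0 hGOS).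
  have B0 : 0 < B by exact: (exp_moment_gt0 hGOS).
  (* The solution [c] of [expR (- c) * A = expR c * B]. *)
  exists (2^-1 * (ln A - ln B)).
  have -> : (fun w => - (phi w + 2^-1 * (ln A - ln B))) =
      (fun w => - phi w + - (2^-1 * (ln A - ln B))).
    by apply/funext => w; rewrite opprD.
  rewrite !(exp_momentD_cst hGOS)// -/A -/B.
  rewrite -[X in _ * X = _](lnK A0) -[X in _ = _ * X](lnK B0) -!expRD.
  by congr expR; field.
move=> phi x y eps saddle Ex Ey.
have [Fphi [/= Xx Yy] phi_min xy_max] := saddle.
have Mx := hXM _ Xx; have My := hYM _ Yy.
have eps0 : 0 < eps by rewrite -Ey; exact: (exp_moment_gt0 hGOS).
have PhiE : Phi P p phi (x, y) = 2 * ln eps.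
  by rewrite /Phi/= Ex Ey mulr_natl mulr2n.
have ExX x' : X x' -> exp_moment P p (fun w => - phi w) x' <= eps.
  move=> Xx'; rewrite -ler_ln ?posrE//; last first.
    apply: (exp_moment_gt0 hGOS); last exact: hXM.
    exact: (finite_dim_spaceN Ffin).
  by have := xy_max (x', y) (conj Xx' Yy); rewrite PhiE /Phi/= Ey; lra.
have EyY y' : Y y' -> exp_moment P p phi y' <= eps.
  move=> Yy'; rewrite -ler_ln ?posrE//; last first.
    by apply: (exp_moment_gt0 hGOS) => //; exact: hYM.
  by have := xy_max (x, y') (conj Xx Yy'); rewrite PhiE /Phi/= Ex; lra.
(* The half log-ratio competes with [phi] in the minimisation over detectors. *)
have eps_affinity : eps <= affinity P p x y.
  have aff0 : 0 < affinity P p x y by exact: (affinity_gt0 hGOS).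
  rewrite -ler_ln ?posrE//.
  have := phi_min _ (half_log_ratio_in hGOS x y Mx My).
  by rewrite PhiE (Phi_half_log_ratio hGOS x y Mx My); lra.
have error_le a :
    (error_X P p X (simple_test (fun w => (phi w - a)%R)) <=
       (expR a * eps)%:E)%E /\
    (error_Y P p Y (simple_test (fun w => (phi w - a)%R)) <=
       (expR (- a) * eps)%:E)%E.
  split.
    apply: (error_X_simple_test hGOS) => //; first exact: Fcst.
    move=> x' Xx'.
    have -> : (fun w => - (phi w - a)) = (fun w => - phi w + a).
      by apply/funext => w; rewrite opprB addrC.
    rewrite (exp_momentD_cst hGOS); [|exact: (finite_dim_spaceN Ffin)|exact: hXM].
    by rewrite ler_pM2l ?expR_gt0// ExX.
  apply: (error_Y_simple_test hGOS) => //; first exact: Fcst.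
  move=> y' Yy'; rewrite (exp_momentD_cst hGOS)//; last exact: hYM.
  by rewrite ler_pM2l ?expR_gt0// EyY.
have risk_le : (risk P p X Y (simple_test phi) <= eps%:E)%E.
  have := error_le 0.
  have -> : (fun w => phi w - 0) = phi by apply/funext => w; rewrite subr0.
  by rewrite oppr0 expR0 mul1r => -[errX errY]; rewrite /risk ge_max errX errY.
split => //.
- split => //; rewrite -PhiE; apply: saddle_point_minmax_value saddle => psi Fpsi.
  exact: (Phi_max_attained hGOS).
- move=> epsilon e0 e12 [T [Ttest err]].
  suff eps_le : eps <= 2 * Num.sqrt (epsilon * (1 - epsilon)).
    by split => //; apply: le_trans risk_le _; rewrite lee_fin.
  have e1 : 0 <= epsilon * (1 - epsilon) by apply: mulr_ge0 => //; lra.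
  have := affinity_sqr_le hGOS x y T (2 * epsilon) Mx My Ttest _ err.
  move=> /(_ ltac:(lra)) aff_le.
  rewrite -[leLHS]ger0_norm ?(ltW eps0)// -sqrtr_sqr.
  have -> : 2 * Num.sqrt (epsilon * (1 - epsilon)) =
      Num.sqrt (2 ^+ 2 * (epsilon * (1 - epsilon))) :> R.
    by rewrite [RHS]sqrtrM ?sqr_ge0// sqrtr_sqr ger0_norm.
  apply: ler_wsqrtr; apply: (@le_trans _ _ (affinity P p x y ^+ 2)).
    by rewrite lerXn2r ?nnegrE ?(ltW eps0)// (le_trans (ltW eps0)).
  by apply: le_trans aff_le _; lra.
- move=> w; have -> // : phi = half_log_ratio p x y.
  apply: (saddle_detector hGOS _ _ _ eps) => //.
  rewrite -(Phi_half_log_ratio hGOS x y Mx My); apply: phi_min.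
  exact: (half_log_ratio_in hGOS).
Qed.
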